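(* For every positive integer $N$, in $\mathrm{PG}(N,2)$ there exists a cutting blocking set of size $\left\lceil\frac{\log(2)}{\log (4/3)}(2N+1) \right\rceil$.
   Context: $\mathrm{PG}(N,2)$ is the $N$-dimensional projective space over the field with two elements. A cutting blocking set of $\mathrm{PG}(N,q)$ is a point set $S$ such that for every hyperplane $H$, $S\cap H$ spans $H$.
   Formalization: For N = 1, 2, 3 the stated size (8, 13, 17) exceeds the number of points of PG(N,2) (3, 7, 15), so the claim is false there; the theorem proves size at most the stated value for all N, and exactly that value whenever it does not exceed 2^(N+1)-1. *)

(* Defs.v *)
From mathcomp Require Import all_boot all_order all_algebra.
From mathcomp Require Import finmap reals exp.

Set Implicit Arguments.
Unset Strict Implicit.
Unset Printing Implicit Defensive.

(* Subspaces of PG(N, F) are the linear subspaces of F^(N+1): a subspace of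
   projective dimension k is one of vector dimension k + 1. *)

Definition pg_point (F : finFieldType) (N : nat) :=
  {P : {vspace 'rV[F]_N.+1} | \dim P == 1%N}.

Definition hyperplane (F : finFieldType) (N : nat)
  (H : {vspace 'rV[F]_N.+1}) : Prop := \dim H = N.

Definition pg_span_in (F : finFieldType) (N : nat) (S : {fset pg_point F N})
  (H : {vspace 'rV[F]_N.+1}) : {vspace 'rV[F]_N.+1} :=
  (\sum_(P <- S | (val P <= H)%VS) val P)%VS.

Definition cutting_blocking_set (F : finFieldType) (N : nat)
  (S : {fset pg_point F N}) : Prop :=
  forall H : {vspace 'rV[F]_N.+1}, hyperplane H -> pg_span_in S H = H.

(* Exceeds the number 2 ^ (N + 1) - 1 of points of PG(N, 2) exactly when N <= 3,
   the values being 8, 13, 17, 22, ... for N = 1, 2, 3, 4, ...; no point set of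
   this size exists in these three cases. *)
Definition cutting_size (R : realType) (N : nat) : int :=
  Num.ceil (ln 2 / ln (4 / 3) * (2 * N%:R + 1) : R)%R.

(* Main.v *)
(* A hyperplane f = 0 is not spanned by its points in S exactly when some
   functional g, independent of f, vanishes on S wherever f does, i.e. when S
   misses {f = 0, g = 1}, which holds a quarter of all vectors.  So m random
   vectors fail a given (f, g) with probability (3/4)^m.  As g and f + g give the
   same condition, there are fewer than 2^(2N+1) conditions, and the union bound
   is below 1 as soon as 2^(2N+1) (3/4)^m <= 1.  Adding points keeps a cutting
   blocking set cutting, so any size up to the number of points can be reached. *)
Require Import Defs.
From mathcomp Require Import all_boot all_order all_algebra.
From mathcomp Require Import finmap reals exp.
From mathcomp Require Import zify lra.

Set Implicit Arguments.
Unset Strict Implicit.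
Unset Printing Implicit Defensive.

Import Order.TTheory GRing.Theory Num.Theory.
Local Open Scope ring_scope.

(** * Counting solutions of linear equations *)

Lemma F2_cases (a : 'F_2) : a = 0 \/ a = 1.
Proof.
case: a => [[|[|a]]] // lt_a; [left | right]; exact: val_inj.
Qed.

Lemma oppr_F2 m n (A : 'M['F_2]_(m, n)) : - A = A.
Proof.
by apply/matrixP => i j; rewrite mxE; case: (F2_cases (A i j)) => ->;
  apply: val_inj.
Qed.

(** A left inverse [B] of [A] turns a difference of values into a translation between the fibers, so
    all fibers are equally large. *)
Lemma card_mulmx_fiber (F : finFieldType) m n (A : 'M[F]_(m, n))
    (w : 'rV[F]_n) :
  row_full A -> (#|[set v : 'rV[F]_m | v *m A == w]| * #|F| ^ n = #|F| ^ m)%N.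
Proof.
move=> /row_fullP[B BA].
have cardE (u : 'rV[F]_n) : #|[set v : 'rV[F]_m | v *m A == u]| =
               #|[set v : 'rV[F]_m | v *m A == w]|.
  rewrite -(card_imset _ (addrI ((w - u) *m B))); apply: eq_card => v.
  rewrite [in RHS]inE; apply/imsetP/eqP => [[x] | vA].
    rewrite inE => /eqP xA ->.
    by rewrite mulmxDl -mulmxA BA mulmx1 xA subrK.
  exists (v - (w - u) *m B); last by rewrite addrC subrK.
  by rewrite inE mulmxBl -mulmxA BA mulmx1 vA opprB addrC subrK.
have := card_mx F 1 m; rewrite mul1n => <-.
rewrite -[RHS]sum1_card (partition_big (fun v : 'rV_m => v *m A) predT) //=.
rewrite (eq_bigr (fun=> #|[set v : 'rV[F]_m | v *m A == w]|)) => [|u _].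
  by rewrite sum_nat_const card_mx mul1n mulnC.
by rewrite sum1_card -(cardE u); apply: eq_card => v; rewrite !inE.
Qed.

(** The only nontrivial combinations over the field with two elements are [f], [g] and [f + g], and
    the last vanishes only if [g = f]. *)
Lemma row_full_F2 n (f g : 'cV['F_2]_n) :
  f != 0 -> g != 0 -> g != f -> row_full (row_mx f g).
Proof.
move=> f0 g0 gf.
rewrite /row_full -mxrank_tr; apply: inj_row_free => u.
rewrite -[u]hsubmxK tr_row_mx mul_row_col.
set a := lsubmx u; set b := rsubmx u.
rewrite [a]mx11_scalar [b]mx11_scalar !mul_scalar_mx => /(congr1 trmx).
rewrite linearD !linearZ /= !trmxK trmx0.
case: (F2_cases (a 0 0)) (F2_cases (b 0 0)) => -> [] ->;
  rewrite ?scale0r ?scale1r ?add0r ?addr0 => /eqP.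
- by move=> _; rewrite !raddf0 row_mx0.
- by rewrite (negPf g0).
- by rewrite (negPf f0).
- by rewrite addrC addr_eq0 oppr_F2 (negPf gf).
Qed.

(** Vectors are rows and functionals are columns, so values are 1 by 1 matrices. *)
Definition cut n (f g : 'cV['F_2]_n) : {set 'rV['F_2]_n} :=
  [set v | (v *m f == 0) && (v *m g == 1%:M)].

Lemma card_cut n (f g : 'cV['F_2]_n) :
  f != 0 -> g != 0 -> g != f -> (#|cut f g| * 4 = 2 ^ n)%N.
Proof.
move=> f0 g0 gf.
rewrite -[in RHS](card_Fp (isT : prime 2)).
rewrite -(card_mulmx_fiber (row_mx 0 1%:M) (row_full_F2 f0 g0 gf)).
rewrite card_Fp //; congr (_ * _)%N; apply: eq_card => v.
rewrite !inE mul_mx_row; apply/andP/eqP => [[/eqP-> /eqP->] //|].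
by case/eq_row_mx => -> ->.
Qed.

Lemma cutDr n (f g : 'cV['F_2]_n) : cut f (f + g) = cut f g.
Proof.
apply/setP => v; rewrite !inE mulmxDr.
by case: eqP => //= ->; rewrite add0r.
Qed.

(** * The union bound as a double count over tuples *)

Lemma sum_card_missed (T I : finType) (A : I -> {set T}) (Q : {set I}) m :
  (\sum_(t : {ffun 'I_m -> T})
      #|[set i in Q | [forall j, t j \notin A i]]| =
   \sum_(i in Q) #|~: A i| ^ m)%N.
Proof.
rewrite (eq_bigr _ (fun t _ => esym (sum1_card _))).
rewrite (exchange_big_dep (mem Q)) => /= [|t i _]; last by rewrite inE; case/andP.
(* The tuples missing [A i] are the functions into its complement. *)
apply: eq_bigr => i iQ; rewrite sum1_card -[m in RHS]card_ord -card_ffun_on.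
apply: eq_card => t; rewrite unfold_in.
rewrite -[LHS]/(i \in [set i in Q | [forall j, t j \notin A i]]) inE iQ /=.
apply/forallP/ffun_onP => tA j; first by rewrite inE.
by have := tA j; rewrite inE.
Qed.

Definition nondegenerate n (f g : 'cV['F_2]_n) := [&& f != 0, g != 0 & g != f].

Lemma nondegenerateDr n (f g : 'cV['F_2]_n) :
  nondegenerate f (f + g) = nondegenerate f g.
Proof.
have -> : nondegenerate f g = [&& f != 0, g != f & g != 0].
  by rewrite /nondegenerate [(g != f) && _]andbC.
congr [&& _, ~~ _ & ~~ _]; first by rewrite addrC addr_eq0 oppr_F2.
by rewrite -subr_eq0 addrC addKr.
Qed.

(** Strictness matters: [exists_hitting] assumes only a weak inequality on [m]. *)
Lemma card_nondegenerate n :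
  (#|[set p : 'cV['F_2]_n * 'cV['F_2]_n | nondegenerate p.1 p.2]|
     < 2 ^ (n + n))%N.
Proof.
have <- : #|{: 'cV['F_2]_n * 'cV['F_2]_n}| = (2 ^ (n + n))%N.
  by rewrite card_prod card_mx card_Fp // muln1 expnD.
rewrite -cardsT; apply/proper_card/properP; split; first exact/subsetP.
by exists (0, 0); rewrite !inE // /nondegenerate eqxx.
Qed.

Lemma exists_hitting N m : (2 ^ (2 * N + 1) * 3 ^ m <= 4 ^ m)%N ->
  exists t : {ffun 'I_m -> 'rV['F_2]_N.+1},
    forall f g, nondegenerate f g -> exists j, t j \in cut f g.
Proof.
move=> le_m.
pose Q := [set p : 'cV['F_2]_N.+1 * 'cV['F_2]_N.+1 | nondegenerate p.1 p.2].
pose A (p : 'cV['F_2]_N.+1 * 'cV['F_2]_N.+1) := cut p.1 p.2.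
pose missed (t : {ffun 'I_m -> 'rV['F_2]_N.+1}) :=
  [set p in Q | [forall j, t j \notin A p]].
have [t t0|missed0] := pickP (fun t => missed t == set0).
  exists t => f g fg; apply/existsP; apply: contraTT t0 => /existsPn mt.
  by apply/set0Pn; exists (f, g); rewrite !inE fg; apply/forallP.
(* A tuple that misses the pair [(f, g)] also misses [(f, f + g)]; this gains the factor 2. *)
have lt1 t : (1 < #|missed t|)%N.
  have /set0Pn[[f g]] := negbT (missed0 t).
  rewrite !inE => /andP[/and3P[/= f0 g0 gf] mt].
  pose q := (f, f + g).
  have ne : (f, g) != q.
    by rewrite /q xpair_eqE eqxx /= -subr_eq0 opprD addrCA subrr addr0 oppr_eq0.
  have : (1 < #|[set (f, g); q]|)%N by rewrite cards2 ne.
  move=> /leq_trans; apply; apply: subset_leq_card.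
  apply/subsetP => p; rewrite !inE => /orP[] /eqP-> /=.
    by rewrite mt /nondegenerate f0 g0 gf.
  by rewrite /q /A /= cutDr mt nondegenerateDr /nondegenerate f0 g0 gf.
have : (2 * (2 ^ N.+1) ^ m <= \sum_t #|missed t|)%N.
  rewrite mulnC.
  have <- : #|{ffun 'I_m -> 'rV['F_2]_N.+1}| = ((2 ^ N.+1) ^ m)%N.
    by rewrite card_ffun card_mx card_Fp // mul1n card_ord.
  by rewrite -sum_nat_const; apply: leq_sum.
have le_cut p : p \in Q -> (#|~: A p| * 4 = 3 * 2 ^ N.+1)%N.
  rewrite inE => /and3P[f0 g0 gf].
  have := cardsC (A p); rewrite card_mx card_Fp // mul1n.
  by have := card_cut f0 g0 gf; rewrite -/(A p); lia.
have : (4 ^ m * \sum_t #|missed t| = #|Q| * (3 ^ m * (2 ^ N.+1) ^ m))%N.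
  rewrite sum_card_missed big_distrr /= -sum_nat_const.
  by apply: eq_bigr => p pQ; rewrite mulnC -!expnMn le_cut.
have := card_nondegenerate N.+1; rewrite -/Q.
have -> : (2 ^ (N.+1 + N.+1) = 2 * 2 ^ (2 * N + 1))%N.
  by rewrite -expnS; congr expn; lia.
have : (0 < (2 ^ N.+1) ^ m)%N by rewrite !expn_gt0.
have : (0 < 3 ^ m)%N by rewrite expn_gt0.
move: le_m; move: ((2 ^ N.+1) ^ m)%N (3 ^ m)%N (4 ^ m)%N #|Q| (\sum_t #|missed t|)%N.
move: (2 ^ (2 * N + 1))%N => e T c d q s le_m c0 T0 q_lt eq_s le_s.
(* The contradiction is [2dT <= ds = qcT < 2ecT <= 2dT], where [T] counts the tuples and [s] the
   missed pairs over all tuples. *)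
have : (q * (c * T) < 2 * e * (c * T))%N by rewrite ltn_pmul2r // muln_gt0 c0.
have : (2 * (e * c) * T <= 2 * d * T)%N by rewrite !leq_mul.
have : (d * (2 * T) <= d * s)%N by rewrite leq_mul.
lia.
Qed.

(** * From hyperplanes and points to functionals and vectors *)

Lemma separating_functional (F : fieldType) n (U : {vspace 'rV[F]_n}) v :
  v \notin U ->
  exists f : 'cV_n, (forall u, u \in U -> u *m f = 0) /\ v *m f != 0.
Proof.
(* The kernel of [P] is exactly [U], so some column of [P] is nonzero at [v]. *)
move=> vU; pose P := 1%:M - lin1_mx (projv U).
have PE u : u *m P = u - projv U u by rewrite mulmxBr mulmx1 mul_rV_lin1.
have /rV0Pn[j vPj] : v *m P != 0.
  by rewrite PE subr_eq0; apply: contraNneq vU => ->; apply: memv_proj.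
exists (col j P); split=> [u uU|].
  by rewrite colE mulmxA PE projv_id // subrr mul0mx.
apply: contraNneq vPj => /matrixP/(_ 0 0).
by rewrite colE mulmxA -colE !mxE => ->.
Qed.

Lemma hyperplane_functional (F : finFieldType) N (H : {vspace 'rV[F]_N.+1}) :
  hyperplane H ->
  exists2 f : 'cV_N.+1, f != 0 & forall v, (v *m f == 0) = (v \in H).
Proof.
rewrite /hyperplane => dimH.
have dimV : \dim {:'rV[F]_N.+1} = N.+1 by rewrite dimvf /dim /= mul1n.
have /subvPn[v _ vH] : ~~ ({:'rV[F]_N.+1} <= H)%VS.
  by apply/negP => /dimvS; rewrite dimV dimH ltnn.
have [f [fH vf]] := separating_functional vH.
exists f => [|u]; first by apply: contraNneq vf => ->; rewrite mulmx0.
(* If [f] also vanished at some [u] outside [H], it would vanish on [H + <[u]>], which is the whole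
   space by dimension. *)
apply/eqP/idP => [uf | /fH //]; apply: contraNT vf => uH.
have : v \in (H + <[u]>)%VS.
  suff -> : (H + <[u]>)%VS = fullv by rewrite memvf.
  have ltHu : (\dim H < \dim (H + <[u]>))%N.
    rewrite ltnNge; apply: contra uH => leuH.
    have /eqP-> : H == (H + <[u]>)%VS by rewrite eqEdim addvSl.
    by rewrite (subvP (addvSr _ _)) // memv_line.
  by apply/eqP; rewrite eqEdim subvf dimV; rewrite dimH in ltHu.
case/memv_addP => h hH [_ /vlineP[k ->] ->].
by rewrite mulmxDl -scalemxAl fH // uf scaler0 addr0.
Qed.

Lemma default_point_subproof (F : finFieldType) N :
  \dim <[const_mx 1 : 'rV[F]_N.+1]> == 1%N.
Proof.
rewrite dim_vline; suff -> : const_mx 1 != 0 :> 'rV[F]_N.+1 by [].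
by apply/rV0Pn; exists 0; rewrite mxE oner_eq0.
Qed.

(* Sends 0 to an arbitrary point. *)
Definition point_of (F : finFieldType) N (v : 'rV[F]_N.+1) : pg_point F N :=
  insubd (exist (fun P : {vspace 'rV_N.+1} => \dim P == 1%N) _
            (default_point_subproof F N)) <[v]>%VS.

Lemma val_point_of (F : finFieldType) N (v : 'rV[F]_N.+1) :
  v != 0 -> val (point_of v) = <[v]>%VS.
Proof. by move=> v0; rewrite insubdK // unfold_in dim_vline v0. Qed.

(** The only nonzero scalar is 1, so each point contains a single nonzero vector. *)
Lemma point_of_inj N :
  {in [set~ 0] &, injective (@point_of 'F_2 N)}.
Proof.
move=> v w; rewrite !inE => v0 w0 /(congr1 val).
rewrite !val_point_of // => vw; have := memv_line v.
rewrite vw => /vlineP[k vE]; move: v0; rewrite vE.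
by case: (F2_cases k) => ->; rewrite ?scale0r ?eqxx // scale1r.
Qed.

Lemma cutting_of_hitting N (B : {set 'rV['F_2]_N.+1}) :
  (forall f g, nondegenerate f g -> exists2 v, v \in B & v \in cut f g) ->
  cutting_blocking_set [fset point_of v | v in B]%fset.
Proof.
move=> hitB H hypH; have [f f0 fH] := hyperplane_functional hypH.
set S := [fset _ | _ in _]%fset.
apply/eqP; rewrite eqEsubv; apply/andP; split.
  by rewrite /pg_span_in; elim/big_ind: _ => [|U V UH VH|//];
    rewrite ?sub0v // subv_add UH.
(* If the span is smaller than [H], some [g] vanishes on it but not at a vector [v] of [H]. A vector
   of [B] in [cut f g] then lies in the span, yet [g] is 1 there. *)
apply/negPn/negP => /subvPn[v vH vS].
have [g [gS vg]] := separating_functional vS.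
have fg : nondegenerate f g.
  rewrite /nondegenerate f0 /=; apply/andP; split.
    by apply: contraNneq vg => ->; rewrite mulmx0.
  by apply: contraNneq vg => ->; rewrite fH.
have [s sB] := hitB _ _ fg; rewrite inE fH => /andP[sH /eqP sg].
have s0 : s != 0.
  by apply/eqP => s0; move/eqP: sg; rewrite s0 mul0mx eq_sym oner_eq0.
have /gS/eqP : s \in pg_span_in S H.
  have sS : point_of s \in (S : seq _) by apply: in_imfset.
  rewrite /pg_span_in (big_rem _ sS) /= val_point_of // -memvE sH.
  by rewrite (subvP (addvSl _ _)) // memv_line.
by rewrite sg oner_eq0.
Qed.

(** * Attaining the prescribed size *)

Lemma exists_set_between (T : finType) (A C : {set T}) k :
  A \subset C -> (#|A| <= k <= #|C|)%N ->
  exists B : {set T}, [/\ A \subset B, B \subset C & #|B| = k].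
Proof.
move=> AC /andP[Ak kC]; pose s := take (k - #|A|) (enum (C :\: A)).
have sCA x : x \in s -> (x \notin A) && (x \in C).
  by move/mem_take; rewrite mem_enum !inE.
exists (A :|: [set x in s]); split; first exact: subsetUl.
  rewrite subUset AC; apply/subsetP => x.
  by rewrite inE => /sCA/andP[].
rewrite cardsU (_ : A :&: _ = set0) ?cards0 ?subn0; last first.
  apply/setP => x; rewrite !inE; apply/andP => -[xA /sCA].
  by rewrite xA.
rewrite cardsE (card_uniqP (take_uniq _ (enum_uniq _))) size_takel ?subnKC //.
by rewrite -cardE cardsD (setIidPr AC) leq_sub2r.
Qed.

(** Taking logarithms, [2 ^ (2 * N + 1) <= (4 / 3) ^ m] says that [m] is at least the real number
    under the ceiling. *)
Lemma cutting_size_natE (R : realType) N :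
  exists2 m : nat, cutting_size R N = m :> int &
    (2 ^ (2 * N + 1) * 3 ^ m <= 4 ^ m)%N.
Proof.
have ln2_gt0 : 0 < ln 2 :> R by rewrite ln_gt0 // ltr1n.
have ln43_gt0 : 0 < ln (4 / 3) :> R by rewrite ln_gt0 //; lra.
have ge0 : 0 <= ln 2 / ln (4 / 3) * (2 * N%:R + 1) :> R.
  apply: mulr_ge0; first by rewrite divr_ge0 ?ltW.
  by rewrite addr_ge0 ?mulr_ge0.
have : 0 <= cutting_size R N by rewrite ceil_ge0 (lt_le_trans (ltrN10 _) ge0).
have := ceil_ge (ln 2 / ln (4 / 3) * (2 * N%:R + 1) : R).
rewrite -/(cutting_size R N); case: (cutting_size R N) => // m lem _.
exists m => //; move: lem; rewrite mulrAC ler_pdivrMr // -pmulrn.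
have -> : 2 * N%:R + 1 = (2 * N + 1)%:R :> R by rewrite natrD natrM.
rewrite mulr_natr [m%:R * _]mulr_natl -!lnXn ?divr_gt0 //.
rewrite ler_ln ?posrE ?exprn_gt0 ?divr_gt0 //.
by rewrite expr_div_n ler_pdivlMr ?exprn_gt0 // -!natrX -natrM ler_nat.
Qed.

Local Close Scope ring_scope.

Theorem theorem5p1 (R : realType) (N : nat) (hN : 0 < N) :
  exists S : {fset pg_point 'F_2 N},
    [/\ cutting_blocking_set S,
        (Posz #|` S|%fset <= cutting_size R N)%R &
        (cutting_size R N <= Posz (2 ^ N.+1 - 1))%R ->
          Posz #|` S|%fset = cutting_size R N].
Proof.
have [m -> le_m] := cutting_size_natE R N.
have [t hit_t] := exists_hitting le_m.
(* The zero vector gives no point and entries of [t] may repeat, so [A] can have fewer than [m]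
   elements and is padded below. *)
pose A := [set t j | j : 'I_m] :\ 0%R.
have cardC : #|[set~ 0%R : 'rV['F_2]_N.+1]| = (2 ^ N.+1 - 1)%N.
  by rewrite cardsC1 card_mx card_Fp // mul1n subn1.
have AC : A \subset [set~ 0%R] by apply/subsetP => v; rewrite !inE => /andP[].
have cardA : (#|A| <= m)%N.
  rewrite (leq_trans (subset_leq_card (subD1set _ _))) //.
  by rewrite (leq_trans (leq_imset_card _ _)) // card_ord.
have [|B [AB BC cardB]] :=
    @exists_set_between _ A [set~ 0%R] (minn m (2 ^ N.+1 - 1)) AC.
  by rewrite leq_min cardA -cardC (subset_leq_card AC) geq_minr.
exists [fset point_of v | v in B]%fset.
rewrite card_in_imfset /=; last first.
  by move=> v w /(subsetP BC) + /(subsetP BC); apply: point_of_inj.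
rewrite -cardE cardB; split.
- apply: cutting_of_hitting => f g /hit_t[j tj]; exists (t j) => //.
  (* Removing 0 is harmless, since [g] takes the value 1 at [t j]. *)
  apply: (subsetP AB); rewrite !inE imset_f // andbT.
  move: tj; rewrite inE => /andP[_]; apply: contraTneq => ->.
  by rewrite mul0mx eq_sym oner_eq0.
- by rewrite lez_nat geq_minl.
- by rewrite lez_nat => /minn_idPl->.
Qed.
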